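(* Let $G$ be a finite Abelian group and let $S$ be a non-empty generating set of $G$ (not assumed to be symmetric). Then $(G,P_S)$ is a finite irreducible Markov chain whose stationary distribution is the uniform distribution on $G$, and $\mathrm{BE}(G,P_S)\ge 0$.
   Context: $G$ is written multiplicatively. ''Generating set'' means $S$ generates $G$ as a group. The stochastic matrix $P_S$ on $G$ is $P_S(x,xs)=1/|S|$ for $x\in G$, $s\in S$, and $P_S(x,y)=0$ if $y\notin xS=\{xs : s\in S\}$. For a stochastic matrix $P$ on a finite set $\mathcal{X}$ and $f,g:\mathcal{X}\to\mathbb{R}$: $\mathcal{L}f(x)=\sum_y P(x,y)(f(y)-f(x))$, $\Gamma(f,g)(x)=\frac12\sum_y (f(x)-f(y))(g(x)-g(y))P(x,y)$, $\Gamma(f)=\Gamma(f,f)$. The Bakry--Émery curvature $\mathrm{BE}(\mathcal{X},P)$ is the supremum of all $\kappa$ such that $\frac12\mathcal{L}\Gamma(f)(x)\ge\Gamma(f,\mathcal{L}f)(x)+\kappa\,\Gamma(f)(x)$ for every $f:\mathcal{X}\to\mathbb{R}$ and $x\in\mathcal{X}$. *)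

(* Defs.v *)
From HB Require Import structures.
From mathcomp Require Import all_boot all_order all_algebra all_fingroup.
From mathcomp Require Import boolp classical_sets reals ereal.

Set Implicit Arguments.
Unset Strict Implicit.
Unset Printing Implicit Defensive.
Import Order.TTheory GRing.Theory Num.Theory.

Local Open Scope ring_scope.

Section MarkovChain.
Variables (R : realType) (X : finType).
Implicit Types (P : X -> X -> R) (pi f g : X -> R).

Definition stochastic P : Prop :=
  (forall x y, 0 <= P x y) /\ (forall x, \sum_y P x y = 1).

Fixpoint nstep P (n : nat) (x y : X) : R :=
  if n is m.+1 then \sum_z P x z * nstep P m z y else (x == y)%:R.

(* Requiring n > 0 is the strictest convention; for a stochastic matrix on a
   finite set it is equivalent to allowing n = 0. *)
Definition irreducible P : Prop :=
  forall x y, exists2 n : nat, (0 < n)%N & 0 < nstep P n x y.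

Definition distribution pi : Prop :=
  (forall x, 0 <= pi x) /\ \sum_x pi x = 1.

Definition stationary P pi : Prop :=
  distribution pi /\ (forall y, \sum_x pi x * P x y = pi y).

Definition uniform : X -> R := fun=> #|X|%:R^-1.

Definition generator P f : X -> R :=
  fun x => \sum_y P x y * (f y - f x).

Definition Gamma P f g : X -> R :=
  fun x => 2^-1 * \sum_y (f x - f y) * (g x - g y) * P x y.

Definition BE_condition P (kappa : R) : Prop :=
  forall f x,
    Gamma P f (generator P f) x + kappa * Gamma P f f x
      <= 2^-1 * generator P (Gamma P f f) x.

(* The supremum is taken in the extended reals: on a one-point space every
   kappa is admissible and the curvature is +oo. *)
Definition BE P : \bar R :=
  ereal_sup [set kappa%:E | kappa in [set k : R | BE_condition P k]]%classic.

End MarkovChain.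

Arguments uniform R X : clear implicits.

Definition cayley_kernel (R : realType) (G : finGroupType) (S : {set G})
    (x y : G) : R :=
  if y \in (x *: S)%g then #|S|%:R^-1 else 0.

Arguments cayley_kernel R {G} S x y.

(* Main.v *)
Require Import Defs.
From mathcomp Require Import all_boot all_order all_algebra all_fingroup.
From mathcomp Require Import reals ereal.
From mathcomp Require Import ring.

(** Write [a_s = f (x s) - f x] and [b_st = f (x s t) - f (x s) - f (x t) + f x].
    Commutativity gives [f (x t s) - f (x t) = a_s + b_st], so that
    [4 |S|^2 (L Gamma(f) / 2 - Gamma(f, L f)) (x)
       = \sum_(s, t) ((a_s + b_st)^2 - a_s^2 - 2 a_s b_st) = \sum_(s, t) b_st^2],
    which is nonnegative. Uniqueness of the stationary distribution is the
    maximum principle: stationarity makes [pi y] the average of [pi (y s^-1)]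
    over [s], so the maximizers of [pi] are stable under the group generated
    by [S]. *)

Import Order.TTheory GRing.Theory Num.Theory.

Local Open Scope ring_scope.

(** In a finite group the inverse of a generator is a power of it, so every element of [<<S>>] is a
    product of elements of [S] and no inverse case arises. Factors are added on the left because
    [nstep] recurses on the first step of a path. *)
Lemma gen_ind_mull (G : finGroupType) (S : {set G}) (K : G -> Prop) :
  K 1%g -> (forall s g, s \in S -> K g -> K (s * g)%g) ->
  forall g, g \in <<S>>%g -> K g.
Proof.
move=> K1 KM g /gen_prodgP[n [c Sc ->]].
by elim/big_rec: _ => // i h _; apply: KM.
Qed.

Section CayleyKernel.
Variables (R : realType) (G : finGroupType) (S : {set G}).
Local Notation P := (cayley_kernel R S).
Local Notation d := (#|S|%:R : R).

Lemma sum_cayley_kernel_row (F : G -> R) x :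
  \sum_y P x y * F y = d^-1 * \sum_(s in S) F (x * s)%g.
Proof.
rewrite (reindex_inj (mulgI x)) /= mulr_sumr [RHS]big_mkcond /=.
apply: eq_bigr => s _; rewrite /cayley_kernel mem_lcoset mulKg.
by case: ifP => // _; rewrite mul0r.
Qed.

(** The predecessors of [y] are the points [y * s^-1], one for each [s] in [S]. This turns
    stationarity into an averaging property. *)
Lemma sum_cayley_kernel_col (F : G -> R) y :
  \sum_x F x * P x y = d^-1 * \sum_(s in S) F (y * s^-1)%g.
Proof.
rewrite (reindex_inj (inj_comp (mulgI y) invg_inj)) /= mulr_sumr.
rewrite [RHS]big_mkcond /=; apply: eq_bigr => s _.
rewrite /cayley_kernel mem_lcoset invMg invgK mulgKV mulrC.
by case: ifP => // _; rewrite mul0r.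
Qed.

Lemma generator_cayley (f : G -> R) x :
  generator P f x = d^-1 * \sum_(s in S) (f (x * s)%g - f x).
Proof. exact: sum_cayley_kernel_row. Qed.

Lemma Gamma_cayley (f g : G -> R) x :
  Gamma P f g x =
  2^-1 * (d^-1 * \sum_(s in S) (f x - f (x * s)%g) * (g x - g (x * s)%g)).
Proof.
rewrite /Gamma; under eq_bigr do rewrite mulrC.
by rewrite sum_cayley_kernel_row.
Qed.

Hypothesis S_neq0 : S != set0.

Lemma card_gen_gt0 : 0 < d.
Proof. by rewrite ltr0n card_gt0. Qed.

Lemma cayley_kernel_ge0 x y : 0 <= P x y.
Proof. by rewrite /cayley_kernel; case: ifP => // _; rewrite invr_ge0 ler0n. Qed.

Lemma cayley_kernel_step_gt0 x s : s \in S -> 0 < P x (x * s)%g.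
Proof.
move=> Ss; rewrite /cayley_kernel mem_lcoset mulKg Ss.
by rewrite invr_gt0 card_gen_gt0.
Qed.

Lemma average_const (c : R) : d^-1 * \sum_(s in S) c = c.
Proof.
by rewrite sumr_const -(mulr_natl c) mulKf // lt0r_neq0 // card_gen_gt0.
Qed.

Lemma stochastic_cayley : stochastic P.
Proof.
split=> [x y|x]; first exact: cayley_kernel_ge0.
under eq_bigr do rewrite -[P x _]mulr1.
by rewrite sum_cayley_kernel_row average_const.
Qed.

Lemma nstep_cayley_ge0 n x y : 0 <= nstep P n x y.
Proof.
elim: n x => [|n IHn] x /=; first by rewrite ler0n.
by apply: sumr_ge0 => z _; rewrite mulr_ge0 ?cayley_kernel_ge0.
Qed.

(** Among the nonnegative terms of the recursion, the one that moves first to [x * s] is already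
    positive. *)
Lemma nstep_cayley_cons n x y s :
  s \in S -> 0 < nstep P n (x * s)%g y -> 0 < nstep P n.+1 x y.
Proof.
move=> Ss n_gt0 /=; rewrite (bigD1 (x * s)%g) //=.
apply: ltr_wpDr; last by rewrite mulr_gt0 ?cayley_kernel_step_gt0.
by apply: sumr_ge0 => z _; rewrite mulr_ge0 ?cayley_kernel_ge0 ?nstep_cayley_ge0.
Qed.

Hypothesis genS : (<<S>> = [set: G])%g.

Lemma irreducible_cayley : irreducible P.
Proof.
have reach g : forall x, exists n, 0 < nstep P n x (x * g)%g.
  have: g \in <<S>>%g by rewrite genS inE.
  elim/gen_ind_mull: g / => [x|s g Ss IHg x].
    by exists 0; rewrite /= mulg1 eqxx ltr01.
  have [n n_gt0] := IHg (x * s)%g.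
  by exists n.+1; apply: (@nstep_cayley_cons _ _ _ s); rewrite // mulgA.
(* [reach] may return a path of length 0, so one step [s] is taken first and [y] is then reached
   from [x * s]; the total length is positive. *)
move=> x y; have /set0Pn[s Ss] := S_neq0.
have [n n_gt0] := reach ((x * s)^-1 * y)%g (x * s)%g.
by exists n.+1 => //; apply: (@nstep_cayley_cons _ _ _ s); rewrite // mulKVg in n_gt0 *.
Qed.

Lemma stationary_cayleyP (pi : G -> R) : stationary P pi <-> pi =1 uniform R G.
Proof.
have G_neq0 : #|G|%:R != 0 :> R.
  by rewrite pnatr_eq0 -lt0n; apply/card_gt0P; exists 1%g.
split=> [[[_ pi1] piP]|piU]; last first.
  split; first split=> [x|]; first by rewrite piU invr_ge0 ler0n.
    under eq_bigr do rewrite piU.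
    by rewrite sumr_const -[LHS]mulr_natl mulfV.
  move=> y; rewrite sum_cayley_kernel_col.
  under eq_bigr do rewrite piU.
  by rewrite average_const piU.
have [y _ pi_max] := Order.TotalTheory.arg_maxP pi (erefl true : xpredT 1%g).
have pi_step z s : s \in S -> pi z = pi y -> pi (z * s^-1)%g = pi y.
  move=> Ss piz.
  (* By stationarity at [z], the mean of these differences is [pi y - pi z = 0]. Each of them is
     nonnegative since [y] is a maximizer, so each vanishes. *)
  have: \sum_(t in S) (pi y - pi (z * t^-1)%g) = 0.
    apply: (mulfI (invr_neq0 (lt0r_neq0 card_gen_gt0))).
    rewrite mulr0 sumrB mulrBr average_const -sum_cayley_kernel_col piP piz.
    exact: subrr.
  move/psumr_eq0P => /(_ _ s Ss) piE; apply/esym/eqP; rewrite -subr_eq0 piE //.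
  by move=> t _; rewrite subr_ge0; apply: pi_max.
have pi_const z : pi z = pi y.
  (* Here [z = y * g^-1] with [g = z^-1 * y], so [z] is reached from the maximizer by inverse
     steps. *)
  have: (z^-1 * y \in <<S>>)%g by rewrite genS inE.
  suff /[apply] : forall g, g \in <<S>>%g -> pi (y * g^-1)%g = pi y.
    by rewrite invMg invgK mulKVg.
  apply: gen_ind_mull => [|s g Ss IHg]; first by rewrite invg1 mulg1.
  by rewrite invMg mulgA pi_step.
(* Total mass 1 fixes the constant value of [pi]. *)
move=> x; rewrite /uniform; apply: (mulfI G_neq0); rewrite mulfV // -[RHS]pi1.
by rewrite (eq_bigr _ (fun z _ => pi_const z)) sumr_const pi_const mulr_natl.
Qed.

End CayleyKernel.

Lemma Bochner_cayley (R : realType) (G : finGroupType) (S : {set G})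
    (f : G -> R) x (P := cayley_kernel R S) :
  abelian [set: G] ->
  2^-1 * generator P (Gamma P f f) x - Gamma P f (generator P f) x =
  (2^-1 * #|S|%:R^-1) ^+ 2 * \sum_(s in S) \sum_(t in S)
    (f (x * s * t)%g - f (x * s)%g - f (x * t)%g + f x) ^+ 2.
Proof.
move=> /centsP abelG; set d := #|S|%:R^-1.
have -> : generator P (Gamma P f f) x =
    d * \sum_(s in S) \sum_(t in S) (2^-1 * d *
      ((f (x * s * t)%g - f (x * t)%g) ^+ 2 - (f (x * s)%g - f x) ^+ 2)).
  (* The variable [t] is the step of the outer generator and [s] the step inside [Gamma]; the sums
     are exchanged to put [t] outermost. *)
  rewrite generator_cayley exchange_big /=; congr (_ * _).
  apply: eq_bigr => t _; rewrite !Gamma_cayley -!mulrBr -sumrB !mulr_sumr.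
  apply: eq_bigr => s _; rewrite -[(x * t * s)%g]mulgA.
  (* Commutativity enters here, replacing [x * t * s] by [x * s * t]. *)
  by rewrite (abelG t _ s) ?inE // mulgA -/d; ring.
have -> : Gamma P f (generator P f) x =
    2^-1 * d * \sum_(s in S) \sum_(t in S) (d * ((f (x * s)%g - f x) *
      (f (x * s * t)%g - f (x * s)%g - f (x * t)%g + f x))).
  rewrite Gamma_cayley mulrA; congr (_ * _).
  apply: eq_bigr => s _; rewrite !generator_cayley -mulrBr -sumrB !mulr_sumr.
  by apply: eq_bigr => t _; rewrite -/d; ring.
rewrite !mulr_sumr -sumrB; apply: eq_bigr => s _.
rewrite !mulr_sumr -sumrB; apply: eq_bigr => t _.
(* Termwise this is [(a + b)^2 - a^2 - 2 a b = b^2], scaled by [(2^-1 * d)^2], with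
   [a = f (x * s) - f x] and [b] the second difference. *)
by field.
Qed.

Lemma BE_condition0_cayley (R : realType) (G : finGroupType) (S : {set G}) :
  abelian [set: G] -> BE_condition (cayley_kernel R S) 0.
Proof.
move=> abelG f x; rewrite mul0r addr0 -subr_ge0 Bochner_cayley //.
rewrite mulr_ge0 ?sqr_ge0 //.
by do 2![apply: sumr_ge0 => ? _]; apply: sqr_ge0.
Qed.

Theorem theorem3p1 (R : realType) (G : finGroupType) (S : {set G})
    (abelG : abelian [set: G]) (S_neq0 : S != set0)
    (genS : (<<S>> = [set: G])%g) :
  [/\ stochastic (cayley_kernel R S),
      irreducible (cayley_kernel R S),
      (forall pi : G -> R,
         stationary (cayley_kernel R S) pi <-> pi =1 uniform R G)
    & (0 <= BE (cayley_kernel R S))%E].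
Proof.
split.
- exact: stochastic_cayley.
- exact: irreducible_cayley.
- exact: stationary_cayleyP.
- by apply: ereal_sup_ubound; exists 0 => //; apply: BE_condition0_cayley.
Qed.
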